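(* Let $n$ be a positive integer, $m:=n^2-n+1$, $p$ a prime, and let $\mathcal X_n$ be the Hurwitz curve $X^nY+Y^nZ+Z^nX=0$ in characteristic $p$. Let $\phi$ denote the Euler function and let $v\ge 0$ be any integer. (1) If $n=p^e$ with $e\ge 1$, then $\mathcal X_n$ is $\mathbf F_{q^2}$-maximal with $q=p^{\phi(m)v+3e}$. (2) If $p\equiv 3\pmod 4$ and $n\equiv 0$ or $1\pmod p$ are such that $m$ is prime and $m\equiv 3\pmod 4$, then $\mathcal X_n$ is $\mathbf F_{q^2}$-maximal with $q=p^{(m-1)v+(m-1)/2}$.
   Context: An $\mathbf F_{q^2}$-maximal curve of genus $g$ is a projective, geometrically irreducible, non-singular algebraic curve defined over $\mathbf F_{q^2}$ whose number of $\mathbf F_{q^2}$-rational points equals $1+q^2+2qg$. *)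

(* Defs.v *)
From HB Require Import structures.
From mathcomp Require Import all_boot all_order all_algebra.
From mathcomp.multinomials Require Import mpoly.

Set Implicit Arguments.
Unset Strict Implicit.
Unset Printing Implicit Defensive.

Import Order.TTheory GRing.Theory Num.Theory.
Local Open Scope ring_scope.

(* The plane curve F = 0 is represented by its homogeneous equation
   F : {mpoly K[3]}, the coordinates X, Y, Z being 'X_0, 'X_1, 'X_2. *)

Definition hurwitz (R : comNzRingType) (n : nat) : {mpoly R[3]} :=
  'X_0 ^+ n * 'X_1 + 'X_1 ^+ n * 'X_2%R + 'X_2%R ^+ n * 'X_0.

Definition irreducible_mpoly (L : fieldType) (F : {mpoly L[3]}) : Prop :=
  [/\ F != 0, F \isn't a GRing.unit &
      forall G H : {mpoly L[3]}, F = G * H ->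
        G \is a GRing.unit \/ H \is a GRing.unit].

Definition projective_plane_curve (K : fieldType) (F : {mpoly K[3]}) : Prop :=
  F != 0 /\ exists2 d : nat, (0 < d)%N & F \is d.-homog.

Definition geometrically_irreducible (K : fieldType) (F : {mpoly K[3]}) :
    Prop :=
  forall (L : closedFieldType) (iota : {rmorphism K -> L}),
    irreducible_mpoly (map_mpoly iota F).

(* Jacobian criterion at every geometric point. *)
Definition nonsingular (K : fieldType) (F : {mpoly K[3]}) : Prop :=
  forall (L : closedFieldType) (iota : {rmorphism K -> L}) (x : 'rV[L]_3),
    x != 0 -> (map_mpoly iota F).@[x 0] = 0 ->
    exists i : 'I_3, ((map_mpoly iota F)^`M(i)).@[x 0] != 0.

(* r = dim_K (K[X,Y,Z] / (F))_k; here U is the degree k part of the ideal (F). *)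
Definition hilbert_function (K : fieldType) (F : {mpoly K[3]}) (k r : nat) :
    Prop :=
  exists U : {vspace dhomog 3 K k},
    (forall G : dhomog 3 K k,
       G \in U <-> exists H : {mpoly K[3]}, (G : {mpoly K[3]}) = H * F)
    /\ (r + \dim U)%N = \dim {: dhomog 3 K k}.

Definition hilbert_polynomial (K : fieldType) (F : {mpoly K[3]})
    (P : {poly rat}) : Prop :=
  exists k0 : nat, forall k : nat, (k0 <= k)%N ->
    exists2 r : nat, hilbert_function F k r & P.[k%:R] = r%:R.

(* Arithmetic genus p_a = (-1)^dim * (P(0) - 1) of a one-dimensional projective
   scheme with Hilbert polynomial P.  For a nonsingular, geometrically
   irreducible curve this is the genus. *)
Definition has_genus (K : fieldType) (F : {mpoly K[3]}) (g : nat) : Prop :=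
  exists2 P : {poly rat}, hilbert_polynomial F P & g%:R = 1 - P.[0].

(* The point [x_0 : x_1 : x_2], as the set of all its homogeneous coordinates. *)
Definition proj_point (K : finFieldType) (x : 'rV[K]_3) : {set 'rV[K]_3} :=
  [set a *: x | a : K & a != 0].

Definition rational_points (K : finFieldType) (F : {mpoly K[3]}) :
    {set {set 'rV[K]_3}} :=
  [set proj_point x | x : 'rV[K]_3 & (x != 0) && (F.@[x 0] == 0)].

(* To be used with #|K| = q ^ 2. *)
Definition maximal_curve (q : nat) (K : finFieldType) (F : {mpoly K[3]}) :
    Prop :=
  [/\ projective_plane_curve F, geometrically_irreducible F, nonsingular F &
      exists2 g : nat, has_genus F g &
        #|rational_points F| = (1 + q ^ 2 + 2 * q * g)%N].

(* Main.v *)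
From HB Require Import structures.
Require Import Defs.
From mathcomp Require Import all_boot all_order all_algebra.
From mathcomp Require Import all_solvable all_field ring zify.
From mathcomp.multinomials Require Import mpoly.

Set Implicit Arguments.
Unset Strict Implicit.
Unset Printing Implicit Defensive.

Import Order.TTheory GRing.Theory Num.Theory.
Local Open Scope ring_scope.

(** Write [m = n ^ 2 - n + 1].  Both cases reduce to [m %| q + 1].  In the
    second one [p] divides [m - 1], so the field with [m] elements contains a
    primitive p-th root of unity [z].  Pairing [i] with [p - i] in the identity
    [p = \prod_(0 < i < p) (1 - z ^ i)] shows that [- p] is a square modulo [m],
    hence [p] is not one, as [m = 3 %[mod 4]], and [p ^ ((m - 1) / 2) = - 1].

    The equation is an Eisenstein polynomial in Z for the prime Y, which gives
    irreducibility in every characteristic.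

    Let [#|K| = q ^ 2].  Off the coordinate axes,
    [b = Y ^ n / (Z ^ (n - 1) X)] maps the curve [m] to one onto the set of [b]
    other than 0 and -1 such that [- b ^ (n - 1) (1 + b)] is an m-th power.
    That condition depends only on the F_q-lines spanned by [b] and [1 + b]: it
    holds for [b] in F_q, and the [b] outside F_q correspond to the ordered
    pairs of distinct F_q-lines of K other than F_q itself.  As
    [b |-> b ^ (q - 1)] identifies the lines with the (q + 1)-th roots of unity,
    the number of points follows by counting pairs of roots of unity. *)

(** * Irreducibility *)

Lemma muniK (n : nat) (R : comNzRingType) (p : {mpoly R[n.+1]}) :
  (map_poly (@mwiden n R) (muni p)).['X_ord_max] = p.
Proof.
rewrite muniE rmorph_sum horner_sum [RHS]mpolyE; apply: eq_bigr => m _.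
rewrite -[_ *: _ *: _]mul_polyC rmorphM /= map_polyC map_polyXn hornerM hornerC.
rewrite hornerXn /= mwidenZ -scalerAl; congr (_ *: _).
rewrite mwidenX (mpolyXE_id _ m) big_ord_recr /= mpolyXE_id big_ord_recr /=.
rewrite mnmwiden_ordmax expr0 mulr1; congr (_ * _).
by apply: eq_bigr => i _; rewrite mnmwiden_widen mnmE.
Qed.

Lemma muniX_widen (n : nat) (R : comNzRingType) (i : 'I_n) :
  muni ('X_(widen_ord (leqnSn n) i) : {mpoly R[n.+1]}) = ('X_i)%:P.
Proof.
rewrite muniE msuppX big_seq1 mcoeffX eqxx scale1r mnm1E.
have -> : (widen_ord (leqnSn n) i == ord_max :> 'I_n.+1) = false.
  by rewrite -val_eqE /= ltn_eqF.
rewrite expr0 -alg_polyC; congr (_ *: _); congr 'X_[_].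
by apply/mnmP => j; rewrite mnmE !mnm1E -!val_eqE.
Qed.

Lemma muniX_max (n : nat) (R : comNzRingType) :
  muni ('X_ord_max : {mpoly R[n.+1]}) = 'X.
Proof.
rewrite muniE msuppX big_seq1 mcoeffX eqxx scale1r mnm1E eqxx expr1.
rewrite (_ : [multinom _ | _ < _] = 0%MM) ?mpolyX0 ?scale1r //.
by apply/mnmP => j; rewrite mnmE mnm1E mnm0E -val_eqE /= gtn_eqF.
Qed.

Lemma mpolyX_neq0 (n : nat) (R : nzRingType) (m : 'X_{1..n}) :
  'X_[m] != 0 :> {mpoly R[n]}.
Proof. by rewrite -msize_poly_eq0 msizeX. Qed.

(** As [a] has a nonzero constant coefficient, induction on the degree kills the coefficients of [b]
    below [n]. Coefficient [n] of the product is then that of [b] times the constant coefficient of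
    [a]. *)
Lemma mul_eq_monomial (D : idomainType) (n : nat) (c : D) (a b : {poly D}) :
  c != 0 -> a * b = c *: 'X^n -> a`_0 != 0 -> (n < size b)%N.
Proof.
move=> c0 ab a0.
have bk k : (k < n)%N -> b`_k = 0.
  elim/ltn_ind: k => k IH kn; apply/eqP.
  have : (a * b)`_k = 0 by rewrite ab coefZ coefXn ltn_eqF ?mulr0.
  rewrite coefM big_ord_recl subn0 big1 ?addr0 => [|i _].
    by move/eqP; rewrite mulf_eq0 (negPf a0).
  by rewrite lift0 IH ?mulr0 //; case: i => /= i; lia.
have : (a * b)`_n != 0 by rewrite ab coefZ coefXn eqxx mulr1.
rewrite coefM big_ord_recl subn0 big1 ?addr0 => [|i _].
  rewrite mulf_eq0 negb_or => /andP[_]; apply: contraR; rewrite -leqNgt.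
  by move/leq_sizeP=> ->.
by rewrite lift0 bk ?mulr0 //; case: i => /= i; lia.
Qed.

Lemma factor_constant (D : idomainType) (n : nat) (a b : {poly D}) :
  a * b != 0 -> (size (a * b)%R <= n.+1)%N -> (n < size b)%N ->
  exists2 c, a = c%:P & forall i, c * b`_i = (a * b)`_i.
Proof.
rewrite mulf_eq0 negb_or => /andP[a0 b0]; rewrite size_mul // => sab sb.
have /size_poly1P[c _ ->] : size a == 1%N.
  by move: a0; rewrite -size_poly_gt0; lia.
by exists c => // i; rewrite coefCM.
Qed.

(* The hypothesis on products says that the constant coefficient does not lie
   in the square of the prime ideal [ker rho]. *)
Lemma eisenstein (D E : idomainType) (rho : {rmorphism D -> E}) (n : nat)
    (c : E) (f g h : {poly D}) :
  c != 0 -> (size f <= n.+1)%N -> map_poly rho f = c *: 'X^n ->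
  (forall a b : D, rho a = 0 -> rho b = 0 -> f`_0 != a * b) ->
  f = g * h ->
  (exists2 e, g = e%:P & forall i, e * h`_i = f`_i) \/
  (exists2 e, h = e%:P & forall i, e * g`_i = f`_i).
Proof.
move=> c0 sf rf f0 fgh; rewrite fgh in sf rf f0 *.
have gh0 : g * h != 0.
  apply/eqP => E0; move/eqP: rf; rewrite E0 rmorph0 eq_sym.
  rewrite -mul_polyC mulf_eq0 polyC_eq0 (negPf c0).
  by rewrite -size_poly_eq0 size_polyXn.
rewrite rmorphM /= in rf.
(* Modulo the kernel of [rho], a factor with nonzero constant coefficient leaves the full degree [n]
   to the other one. If both constant coefficients vanish, their product contradicts the hypothesis
   on [f]. *)
have [g0|g0] := eqVneq ((map_poly rho g)`_0) 0; last first.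
  left; apply: (factor_constant gh0 sf).
  exact: leq_trans (mul_eq_monomial c0 rf g0) (size_poly _ _).
have [h0|h0] := eqVneq ((map_poly rho h)`_0) 0; last first.
  right; rewrite mulrC in gh0 sf *; rewrite mulrC in rf.
  apply: (factor_constant gh0 sf).
  exact: leq_trans (mul_eq_monomial c0 rf h0) (size_poly _ _).
move: g0 h0; rewrite !coef_map /= => g0 h0.
by have := f0 _ _ g0 h0; rewrite coef0M eqxx.
Qed.

(** At the point (0, 1) the second equation gives [c] a nonzero value, so the first makes [d] vanish
    there. Hence [d] is not constant and takes up the whole degree of ['X_0]. *)
Lemma common_factor_cst (L : fieldType) (n : nat) (c d e : {mpoly L[2]}) :
  c * d = 'X_0 -> c * e = 'X_1%R ^+ n -> c = (c@_0)%:MP.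
Proof.
move=> cd ce.
pose v (i : 'I_2) : L := (i == 1)%:R.
have cv : c.@[v] != 0.
  apply/eqP => cv; move/(congr1 (meval v))/eqP: ce.
  by rewrite rmorphM /= cv mul0r rmorphXn /= mevalXU expr1n eq_sym oner_eq0.
have : c * d != 0 by rewrite cd mpolyX_neq0.
rewrite mulf_eq0 negb_or => /andP[c0 d0].
have dv : d.@[v] = 0.
  move/(congr1 (meval v))/eqP: cd; rewrite rmorphM /= mevalXU.
  by rewrite mulf_eq0 (negPf cv) => /eqP.
have sd : (1 < msize d)%N.
  rewrite ltnNge; apply/negP => /msize1_polyC E.
  by move: d0; rewrite E mpolyC_eq0 -(mevalC v (d@__)) -E dv eqxx.
apply: msize1_polyC; have := congr1 (fun p => msize p) cd.
rewrite /= msizeM // msizeX mdeg1; move: (msize c) (msize d) sd => a b.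
by clear; lia.
Qed.

Lemma muni_hurwitz (R : comNzRingType) (n : nat) :
  muni (hurwitz R n) =
  'X_0 *: 'X^n + 'X_1%R ^+ n *: 'X + ('X_0 ^+ n * 'X_1%R)%:P.
Proof.
rewrite /hurwitz.
have -> : (2%R : 'I_3) = ord_max by apply/val_inj.
have -> : (0 : 'I_3) = widen_ord (leqnSn _) (0 : 'I_2) by apply/val_inj.
have -> : (1 : 'I_3) = widen_ord (leqnSn _) (1 : 'I_2) by apply/val_inj.
rewrite !rmorphD !rmorphM !rmorphXn /= !muniX_widen muniX_max -!mul_polyC.
rewrite !rmorphXn /= ['X^n * _]mulrC addrC -addrA; congr (_ + _).
by rewrite addrC.
Qed.

Lemma coef_muni_hurwitz (R : comNzRingType) (n i : nat) :
  (muni (hurwitz R n))`_i = 'X_0 *+ (i == n) + 'X_1%R ^+ n *+ (i == 1)%N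
    + ('X_0 ^+ n * 'X_1%R) *+ (i == 0)%N.
Proof.
by rewrite muni_hurwitz !coefD !coefZ coefXn coefX coefC; case: (i == n);
  case: (i == 1)%N; case: (i == 0)%N; rewrite ?mulr1 ?mulr0 ?mulr1n ?mulr0n.
Qed.

Lemma size_muni_hurwitz (R : comNzRingType) (n : nat) :
  (1 < n)%N -> (size (muni (hurwitz R n)) <= n.+1)%N.
Proof.
move=> n_gt1; apply/leq_sizeP => j jn; rewrite coef_muni_hurwitz gtn_eqF //.
have [-> ->] : (j == 1)%N = false /\ (j == 0)%N = false by lia.
by rewrite !addr0.
Qed.

Lemma hurwitz_neq0 (R : comNzRingType) (n : nat) :
  (1 < n)%N -> hurwitz R n != 0.
Proof.
move=> n_gt1; apply/eqP => /(congr1 (fun p => (muni p)`_n)) /eqP.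
rewrite raddf0 coef_muni_hurwitz eqxx coef0 gtn_eqF //.
by rewrite gtn_eqF ?(ltnW n_gt1) // !addr0 (negPf (mpolyX_neq0 _ _)).
Qed.

(** A factor free of Z divides each coefficient of the equation in Z, in particular X at Z ^ n and Y
    ^ n at Z; this is where [d] and [e] come from. *)
Lemma hurwitz_factor_unit (L : fieldType) (n : nat) (G H : {mpoly L[3]})
    (c d e : {mpoly L[2]}) :
  (1 < n)%N -> hurwitz L n = G * H -> muni G = c%:P ->
  c * d = 'X_0 -> c * e = 'X_1%R ^+ n -> G \is a GRing.unit.
Proof.
move=> n_gt1 FGH Gc cd ce.
have cE := common_factor_cst cd ce.
have GE : G = (c@_0)%:MP.
  by rewrite -(muniK G) Gc map_polyC hornerC /= {1}cE mwidenC.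
have : G != 0.
  by apply: contraTneq (hurwitz_neq0 L n_gt1) => G0; rewrite FGH G0 mul0r negbK.
rewrite GE mpolyC_eq0 -unitfE => /(rmorph_unit (@mpolyC 3 L)).
by [].
Qed.

Lemma hurwitz_irreducible (L : fieldType) (n : nat) :
  (1 < n)%N -> irreducible_mpoly (hurwitz L n).
Proof.
move=> n_gt1; have n_gt0 := ltnW n_gt1; split; first exact: hurwitz_neq0.
  apply/negP => /(rmorph_unit (meval (fun=> 0 : L))).
  by rewrite !rmorphD !rmorphM !rmorphXn /= !mevalXU !mulr0 !addr0 unitr0.
move=> G H FGH.
(* [rho] is reduction modulo Y: it keeps X and sends Y to 0. *)
have [rho [rx ry]] : exists rho : {rmorphism {mpoly L[2]} -> {poly L}},
    rho 'X_0 = 'X /\ rho 'X_1%R = 0.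
  exists (mmap polyC (fun i => if i == 0 then 'X else 0)).
  by rewrite /= !mmapX !mmap1U.
have gh : muni (hurwitz L n) = muni G * muni H by rewrite FGH rmorphM.
have rgh : map_poly rho (muni (hurwitz L n)) = 'X *: 'X^n.
  rewrite muni_hurwitz !rmorphD /= !map_polyZ map_polyC map_polyX.
  rewrite map_polyXn /= rmorphM !rmorphXn /= rx ry expr0n mulr0 gtn_eqF //.
  by rewrite scale0r !addr0.
have X0 : 'X != 0 :> {poly L} by rewrite polyX_eq0.
have f0 (a b : {mpoly L[2]}) : rho a = 0 -> rho b = 0 ->
    (muni (hurwitz L n))`_0 != a * b.
  move=> ra rb; rewrite coef_muni_hurwitz eqxx ltn_eqF // !add0r.
  (* If Y divides both [a] and [b], the Y-derivative of [a * b] vanishes at Y = 0, whereas that of X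
     ^ n Y is X ^ n. *)
  apply/eqP => /(congr1 (rho \o mderiv 1)) /=.
  rewrite !mderivM !rmorphD !rmorphM /= ra rb ry.
  rewrite !(mul0r, mulr0) !add0r.
  rewrite mderivX mnm1E eqxx scale1r -[X in (X - _)%MM]add0m addmK mpolyX0.
  rewrite rmorph1 mulr1 rmorphXn rx.
  by apply/eqP; rewrite -size_poly_eq0 size_polyXn.
have cn : (muni (hurwitz L n))`_n = 'X_0.
  by rewrite coef_muni_hurwitz eqxx !gtn_eqF // !addr0.
have c1 : (muni (hurwitz L n))`_1 = 'X_1%R ^+ n.
  by rewrite coef_muni_hurwitz eqxx ltn_eqF // addr0 add0r.
have [[e Ge eH]|[e He eG]] :=
    eisenstein X0 (size_muni_hurwitz L n_gt1) rgh f0 gh.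
- left; apply: (hurwitz_factor_unit n_gt1 FGH Ge).
    exact: etrans (eH n) cn.
  exact: etrans (eH 1%N) c1.
- rewrite mulrC in FGH.
  right; apply: (hurwitz_factor_unit n_gt1 FGH He).
    exact: etrans (eG n) cn.
  exact: etrans (eG 1%N) c1.
Qed.

(** * Nonsingularity and genus *)

Lemma hurwitz_homog (R : comNzRingType) (n : nat) : hurwitz R n \is n.+1.-homog.
Proof.
have h1 (i : 'I_3) : ('X_i : {mpoly R[3]}) \is 1.-homog.
  by rewrite dhomogX /= mdeg1.
have h (i j : 'I_3) : ('X_i ^+ n * 'X_j : {mpoly R[3]}) \is n.+1.-homog.
  by have := dhomogM (dhomogMn n (h1 i)) (h1 j); rewrite mul1n addn1.
by rewrite !rpredD.
Qed.

Lemma map_hurwitz (R S : comNzRingType) (f : {rmorphism R -> S}) (n : nat) :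
  map_mpoly f (hurwitz R n) = hurwitz S n.
Proof. by rewrite !rmorphD !rmorphM !rmorphXn /= !map_mpolyX. Qed.

Lemma mderivXn (m n : nat) (R : comNzRingType) (i j : 'I_m) :
  ('X_j ^+ n : {mpoly R[m]})^`M(i) = if i == j then n%:R *: 'X_j ^+ n.-1 else 0.
Proof.
rewrite !mpolyXn mderivX mulmnE mnm1E [j == i]eq_sym.
case: eqP => [->|_]; last by rewrite mul0n scale0r.
rewrite mul1n; case: n => [|n]; first by rewrite !scale0r.
by congr (_ *: 'X_[_]); rewrite mulmS addmC addmK.
Qed.

Lemma mderivXU (m : nat) (R : comNzRingType) (i j : 'I_m) :
  ('X_j : {mpoly R[m]})^`M(i) = (i == j)%:R.
Proof.
rewrite -[X in X^`M(i)]expr1 mderivXn; case: eqP => // _.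
by rewrite expr0 scale1r.
Qed.

Lemma meval_mderivXnX (m n : nat) (R : comNzRingType) (v : 'I_m -> R)
    (i j k : 'I_m) :
  (('X_j ^+ n * 'X_k : {mpoly R[m]})^`M(i)).@[v] =
  (if i == j then n%:R * v j ^+ n.-1 * v k else 0)
  + (if i == k then v j ^+ n else 0).
Proof.
rewrite mderivM mderivXn mderivXU mevalD !mevalM (fun_if (meval v)) mevalZ.
rewrite meval0 !rmorphXn /= !mevalXU rmorph_nat.
by case: (i == j); case: (i == k); rewrite ?mul0r ?mulr1 ?mulr0.
Qed.

Lemma hurwitz_jacobian_coord (L : fieldType) (k : nat) (x y z : L) :
  x ^+ k.+1 * y = 0 -> y ^+ k.+1 + k.+1%:R * z ^+ k * x = 0 -> y = 0.
Proof.
move/eqP; rewrite mulf_eq0 expf_eq0 /= => /orP[/eqP->|/eqP-> //].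
by rewrite mulr0 addr0 => /eqP; rewrite expf_eq0 => /eqP.
Qed.

(** Let N = k + 1 and let A, B, C be the three monomials of F. Then x F_x = N A + C and z F_z = B +
    N C, so F + (N - 1) x F_x - z F_z = (N ^ 2 - N + 1) A. Hence A vanishes, then C and B, and each
    coordinate follows from one monomial and one partial derivative. *)
Lemma hurwitz_jacobian (L : fieldType) (k : nat) (x y z : L) :
  k.+1%:R ^+ 2 - k.+1%:R + 1 != 0 :> L ->
  x ^+ k.+1 * y + y ^+ k.+1 * z + z ^+ k.+1 * x = 0 ->
  k.+1%:R * x ^+ k * y + z ^+ k.+1 = 0 ->
  x ^+ k.+1 + k.+1%:R * y ^+ k * z = 0 ->
  y ^+ k.+1 + k.+1%:R * z ^+ k * x = 0 ->
  [/\ x = 0, y = 0 & z = 0].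
Proof.
move=> m0; set N := k.+1%:R in m0 *; move=> F0 d0 d1 d2.
have E (a : L) : a ^+ k.+1 = a * a ^+ k by rewrite exprS.
have A0 : x ^+ k.+1 * y = 0.
  apply/eqP; rewrite -(mulrI_eq0 _ (mulfI m0)); apply/eqP.
  transitivity ((x ^+ k.+1 * y + y ^+ k.+1 * z + z ^+ k.+1 * x)
    + (N - 1) * (x * (N * x ^+ k * y + z ^+ k.+1))
    - z * (y ^+ k.+1 + N * z ^+ k * x)); first by rewrite !E; ring.
  by rewrite F0 d0 d2; ring.
have C0 : z ^+ k.+1 * x = 0.
  transitivity (x * (N * x ^+ k * y + z ^+ k.+1) - N * (x ^+ k.+1 * y)).
    by rewrite !E; ring.
  by rewrite d0 A0; ring.
have B0 : y ^+ k.+1 * z = 0 by move: F0; rewrite A0 C0 add0r addr0.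
split.
- by apply: hurwitz_jacobian_coord C0 d1.
- by apply: hurwitz_jacobian_coord A0 d2.
- by apply: hurwitz_jacobian_coord B0 _; rewrite addrC; exact: d0.
Qed.

Lemma hurwitz_nonsingular (K : fieldType) (n : nat) :
  (1 < n)%N -> (n ^ 2 - n + 1)%N%:R != 0 :> K -> nonsingular (hurwitz K n).
Proof.
move=> n_gt1 m0 L iota w w0; rewrite map_hurwitz.
have {}m0 : (n%:R ^+ 2 - n%:R + 1) != 0 :> L.
  rewrite -(fmorph_eq0 iota) in m0; move: m0.
  by rewrite rmorph_nat natrD natrB ?natrX // expnS leq_pmulr // expn1 ltnW.
rewrite !rmorphD !rmorphM !rmorphXn /= !mevalXU => F0.
apply/existsP; apply: contraNT w0 => /existsPn h.
have {}h i : ((hurwitz L n)^`M(i)).@[w 0] = 0.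
  by apply/eqP; have := h i; rewrite negbK.
set x := w 0 0 in F0; set y := w 0 1 in F0; set z := w 0 2%R in F0.
have n1 : n = n.-1.+1 by rewrite prednK // ltnW.
have [x0 y0 z0] : [/\ x = 0, y = 0 & z = 0].
  apply: (@hurwitz_jacobian _ n.-1); rewrite -?n1 //.
  - have := h 0; rewrite /hurwitz !mderivD !mevalD !meval_mderivXnX /=.
    by rewrite ?(addr0, add0r).
  - have := h 1; rewrite /hurwitz !mderivD !mevalD !meval_mderivXnX /=.
    by rewrite ?(addr0, add0r).
  - have := h 2%R; rewrite /hurwitz !mderivD !mevalD !meval_mderivXnX /=.
    by rewrite ?(addr0, add0r).
apply/eqP/rowP => i; rewrite mxE.
by case: i => [[|[|[|i]]] hi] //; [rewrite -x0|rewrite -y0|rewrite -z0];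
  congr (w _ _); apply/val_inj.
Qed.

(** Multiplication by a form of degree [d] shifts degrees by [d], so only the degree [j] component
    of [H] contributes. Hence the cofactor of a homogeneous multiple of [F] can be taken
    homogeneous. *)
Lemma pihomogM (m : nat) (R : comNzRingType) (j d : nat) (H F : {mpoly R[m]}) :
  F \is d.-homog ->
  pihomog mdeg (j + d)%N (H * F) = pihomog mdeg j H * F.
Proof.
move=> hF; have hH : (msize H <= maxn (msize H) j.+1)%N by rewrite leq_maxl.
have hj : (j < maxn (msize H) j.+1)%N by rewrite leq_maxr.
rewrite [in LHS](pihomog_partitionE hH) mulr_suml raddf_sum /=.
rewrite (bigD1 (Ordinal hj)) //= pihomog_dE; last exact/dhomogM/hF/pihomogP.
rewrite big1 ?addr0 // => e ej.
apply: (pihomog_ne0 (d := (e + d)%N)); last exact/dhomogM/hF/pihomogP.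
by rewrite eqn_add2r -(inj_eq val_inj) in ej *.
Qed.

Lemma dim_dhomog3 (K : fieldType) (k : nat) :
  \dim {: dhomog 3 K k} = 'C(k.+2, 2).
Proof.
have -> : 'C(k.+2, 2) = 'C((k + 2)%N, k).
  by rewrite -[RHS]bin_sub ?leq_addr // addKn addn2.
by rewrite dimvf.
Qed.

Section Multiplication.
Variables (K : fieldType) (d j : nat) (F : {mpoly K[3]}).
Hypothesis hF : F \is d.-homog.

(** The degree [j + d] part of the ideal of [F] is the image of this map, which is injective when
    [F] is nonzero. *)
Definition dhomog_mul (G : dhomog 3 K j) : dhomog 3 K (j + d)%N :=
  DHomog (dhomogM (dhomog_is_dhomog G) hF).

Lemma dhomog_mul_is_linear : linear dhomog_mul.
Proof. by move=> a G H; apply/val_inj; rewrite /= mulrDl scalerAl. Qed.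

HB.instance Definition _ :=
  GRing.isLinear.Build K (dhomog 3 K j) (dhomog 3 K (j + d)%N) _ dhomog_mul
    dhomog_mul_is_linear.

Lemma hilbert_function_dhomog (F0 : F != 0) :
  hilbert_function F (j + d)%N ('C((j + d).+2, 2) - 'C(j.+2, 2))%N.
Proof.
exists (limg (linfun dhomog_mul)); split.
  move=> G; split=> [/memv_imgP[H _ ->]|[H GE]].
    by exists H; rewrite lfunE.
  pose H' := DHomog (pihomogP mdeg j H).
  apply/memv_imgP; exists H'; rewrite ?memvf // lfunE; apply/val_inj => /=.
  rewrite -(pihomogM _ _ hF) -GE pihomog_dE //.
  exact: dhomog_is_dhomog.
rewrite -!(dim_dhomog3 K).
have ker0 : lker (linfun dhomog_mul) == 0%VS.
  apply/lker0P => G H; rewrite !lfunE => /(congr1 val) /=.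
  by move/(mulIf F0)/val_inj.
rewrite limg_dim_eq ?(eqP ker0) ?capv0 // subnK //.
rewrite -(limg_dim_eq (f := linfun dhomog_mul)); first exact/dimvS/subvf.
by rewrite (eqP ker0) capv0.
Qed.
End Multiplication.

Lemma plane_curve_genus (K : fieldType) (d : nat) (F : {mpoly K[3]}) :
  F != 0 -> F \is d.+1.-homog -> has_genus F 'C(d, 2).
Proof.
move=> F0 hF.
have bin2R (m : nat) : ('C(m.+1, 2))%:R = m.+1%:R * m%:R / 2 :> rat.
  have /(congr1 (fun i => i%:R : rat)) := mul_bin_diag m.+1 1.
  rewrite bin1 !natrM => ->; by field.
(* For D = d + 1 and k >= D, the dimension (k + 2)(k + 1)/2 - (k - D + 2)(k - D + 1)/2 simplifies to
   D k + (3 D - D ^ 2)/2. *)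
pose P : {poly rat} := d.+1%:R *: 'X + ((3 * d.+1%:R - d.+1%:R ^+ 2) / 2)%:P.
exists P; rewrite {}/P; last first.
  rewrite hornerD hornerZ hornerX hornerC.
  case: d {hF} => [|d]; first by rewrite bin_small //; field.
  by rewrite bin2R -!natr1; field.
exists d.+1 => k dk; exists ('C(k.+2, 2) - 'C((k - d.+1).+2, 2))%N.
  rewrite -[in X in hilbert_function _ X _](subnK dk).
  by rewrite -[in X in 'C(X, _)](subnK dk); exact: hilbert_function_dhomog.
rewrite natrB; last first.
  by apply: leq_bin2l; rewrite !ltnS leq_subr.
rewrite !bin2R hornerD hornerZ hornerX hornerC -!natr1 natrB // -!natr1.
by field.
Qed.

(** * Counting the rational points *)

Lemma card_set_bij (S T : finType) (A : {set S}) (B : {set T})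
    (f : S -> T) (g : T -> S) :
  {in A, forall x, f x \in B} -> {in B, forall y, g y \in A} ->
  {in A, cancel f g} -> {in B, cancel g f} -> #|A| = #|B|.
Proof.
move=> fAB gBA fK gK; rewrite -(card_in_imset (can_in_inj fK)).
apply: eq_card => y.
apply/imsetP/idP => [[x xA ->]|yB]; first exact: fAB.
by exists (g y); rewrite ?gBA ?gK.
Qed.

Lemma card_set_pair (S T : finType) (Q : S -> T -> bool) :
  #|[set x : S * T | Q x.1 x.2]| = (\sum_a #|[set b | Q a b]|)%N.
Proof.
under [RHS]eq_bigr do rewrite -sum1dep_card.
by rewrite -sum1dep_card pair_big_dep.
Qed.

Lemma exprn_eq1_neq0 (F : fieldType) (j : nat) (x : F) :
  x ^+ j.+1 = 1 -> x != 0.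
Proof.
by apply: contra_eq_neq => ->; rewrite expr0n eq_sym oner_neq0.
Qed.

Section Roots.
Variable K : finFieldType.

Lemma finField_prim_root : {w : K | (#|K|.-1).-primitive_root w}.
Proof.
have K1 : (1 < #|K|)%N := finNzRing_gt1 K.
have N0 : (0 < #|K|.-1)%N by lia.
have : has (#|K|.-1).-primitive_root (enum (predC1 (0 : K))).
  apply: has_prim_root; rewrite ?enum_uniq //.
    apply/allP => x; rewrite mem_enum inE => x0.
    apply/unity_rootP/(mulIf x0); rewrite mul1r -exprSr prednK ?expf_card //.
    by rewrite ltnW ?finNzRing_gt1.
  by rewrite -cardE cardC1.
by move/hasP/sig2W => [w _ pw]; exists w.
Qed.

Lemma finField_exp_eq1 (x : K) : x != 0 -> x ^+ #|K|.-1 = 1.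
Proof.
move=> x0; apply: (mulIf x0); rewrite mul1r -exprSr prednK ?expf_card //.
by rewrite ltnW ?finNzRing_gt1.
Qed.

(** The multiplicative group is cyclic of order [d * e]: its d-th powers are the elements whose e-th
    power is 1, and the d-th roots of such an element form a coset of the d-th roots of unity. *)
Lemma card_nth_roots (d e : nat) (c : K) :
  (d * e)%N = #|K|.-1 -> c != 0 ->
  #|[set y : K | y ^+ d == c]| = if c ^+ e == 1 then d else 0%N.
Proof.
move=> de c0; have [w pw] := finField_prim_root.
have := prim_order_gt0 pw; rewrite -{1}de muln_gt0 => /andP[d0 e0].
have w0 : w != 0.
  apply: (@exprn_eq1_neq0 _ #|K|.-2).
  by rewrite prednK ?(prim_order_gt0 pw) // prim_expr_order.
case: eqP => [ce|ce]; last first.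
  apply/eqP; rewrite cards_eq0; apply/eqP/setP => y; rewrite !inE.
  apply/negP => /eqP yd; apply: ce; rewrite -yd -exprM de finField_exp_eq1 //.
  by apply: contra_eq_neq yd => ->; rewrite expr0n gtn_eqF // eq_sym.
have pz : d.-primitive_root (w ^+ e).
  have dN : (d %| #|K|.-1)%N by rewrite -de dvdn_mulr.
  by have := dvdn_prim_root pw dN; rewrite -de mulKn.
have [i cE] := prim_rootP pw (finField_exp_eq1 c0).
have di : (d %| i)%N.
  by rewrite -(dvdn_pmul2r e0) de (prim_order_dvd pw) exprM -cE ce.
have z0 : w ^+ (i %/ d) != 0 by rewrite expf_neq0.
have yd : (w ^+ (i %/ d)) ^+ d = c by rewrite -exprM divnK.
have inj : injective (fun j : 'I_d => w ^+ (i %/ d) * (w ^+ e) ^+ j).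
  move=> j1 j2 /(mulfI z0)/eqP; rewrite (eq_prim_root_expr pz) !modn_small //.
  by move=> /eqP/val_inj.
rewrite -[RHS]card_ord -cardsT -(card_imset _ inj); apply: eq_card => y.
rewrite inE; apply/eqP/imsetP => [yc|[j _ ->]]; last first.
  by rewrite exprMn yd [_ ^+ j ^+ d]exprAC (prim_expr_order pz) expr1n mulr1.
have : (y / w ^+ (i %/ d)) ^+ d = 1 by rewrite expr_div_n yc yd divff.
by move=> /(prim_rootP pz)[j yj]; exists j; rewrite // -yj mulrC divfK.
Qed.
End Roots.

Lemma sqr_sub_addn1 (n : nat) :
  (0 < n)%N -> (n ^ 2 - n + 1)%N = (n * n.-1).+1.
Proof. by rewrite -mulnn; case: n => // a _; lia. Qed.

(** * Points off the coordinate axes, with k = (q + 1) / m *)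

Section TorusCount.
Variables (K : finFieldType) (q n k : nat).
Hypothesis qD : {morph (fun x : K => x ^+ q) : x y / x + y}.
Hypothesis q_gt1 : (1 < q)%N.
Hypothesis cardK : #|K| = (q ^ 2)%N.
Hypothesis n_gt0 : (0 < n)%N.
Let m := (n ^ 2 - n + 1)%N.
Hypothesis mk : (m * k)%N = q.+1.

Lemma card_pred : #|K|.-1 = (q.+1 * q.-1)%N.
Proof. by rewrite cardK -mulnn; case: q q_gt1 => // a _; lia. Qed.


Let mE : m = (n * n.-1).+1 := sqr_sub_addn1 n_gt0.

(** Both [n] and [n.-1] divide [m - 1], so [x ^+ j = 1] forces [x ^+ (m - 1) = 1]. *)
Lemma m_expr_eq1 (x : K) j : j = n \/ j = n.-1 ->
  x ^+ m = 1 -> x ^+ j = 1 -> x = 1.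
Proof.
move=> jn xm xj; have : x ^+ (n * n.-1) = 1.
  by case: jn xj => <- xj; [rewrite exprM|rewrite mulnC exprM];
    rewrite xj expr1n.
by move=> E; rewrite -xm mE exprS E mulr1.
Qed.

Lemma card_pred_k : (k * (m * q.-1))%N = #|K|.-1.
Proof. by rewrite mulnA [(k * m)%N]mulnC mk card_pred. Qed.

Lemma k_gt0 : (0 < k)%N. Proof. by move: mk; case: k => //; rewrite muln0. Qed.

(* The pairs [(b ^ (q - 1), (1 + b) ^ (q - 1))] for the admissible [b] outside
   the fixed field of [x |-> x ^ q]. *)
Definition slopes : {set K * K} := [set gh | [&& gh.1 ^+ q.+1 == 1,
  gh.2 ^+ q.+1 == 1, gh.1 != 1, gh.2 != 1, gh.1 != gh.2 &
  (gh.1 ^+ n.-1 * gh.2) ^+ k == 1]].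

Lemma unity_k (g : K) : g ^+ k == 1 -> g ^+ q.+1 == 1.
Proof. by move=> /eqP gk; rewrite -mk mulnC exprM gk expr1n. Qed.

(** The last condition makes [h] a k-th root of an m-th root of unity, which leaves [k] values, all
    of them (q + 1)-th roots of unity. The excluded value 1 or [g] is among them only if the (n -
    1)-th or n-th power of [g ^+ k] is 1, which forces [g ^+ k = 1]; in that case both are. *)
Lemma card_slope_fiber (g : K) : g != 1 -> g ^+ q.+1 = 1 ->
  #|[set h | [&& h ^+ q.+1 == 1, h != 1, g != h & (g ^+ n.-1 * h) ^+ k == 1]]| =
  if g ^+ k == 1 then (k - 2)%N else k.
Proof.
move=> g1 gq.
have g0 := exprn_eq1_neq0 gq.
case: eqP => gk.
  rewrite -[in RHS](_ : #|[set h : K | h ^+ k == 1]| = k); last first.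
    by rewrite (card_nth_roots card_pred_k (oner_neq0 _)) expr1n eqxx.
  rewrite [X in _ = (X - 2)%N](cardsD1 1) [X in _ = (_ + X - 2)%N](cardsD1 g).
  rewrite !inE expr1n gk !eqxx g1 /= !add1n subn2 /=.
  apply: eq_card => h; rewrite !inE exprMn exprAC gk expr1n mul1r.
  case: (h ^+ k =P 1) => hk; rewrite ?andbF ?andbT //.
  by have /eqP/unity_k-> := hk; rewrite /= [h == g]eq_sym andbC.
pose c := (g ^+ n.-1 ^+ k)^-1.
have c0 : c != 0 by rewrite invr_eq0 !expf_neq0.
have cm : c ^+ m = 1.
  rewrite exprVn -!exprM -mulnA [(k * m)%N]mulnC mk mulnC exprM gq.
  by rewrite expr1n invr1.
rewrite -[RHS](_ : #|[set h : K | h ^+ k == c]| = k); last first.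
  by rewrite (card_nth_roots card_pred_k c0) exprM cm expr1n eqxx.
have gkm : (g ^+ k) ^+ m = 1 by rewrite -exprM mulnC mk.
apply: eq_card => h; rewrite !inE exprMn.
have -> : (g ^+ n.-1 ^+ k * h ^+ k == 1) = (h ^+ k == c).
  by rewrite -(inj_eq (mulfI c0)) mulrA mulVf ?expf_neq0 // mul1r mulr1.
case: (h ^+ k =P c) => hk; rewrite ?andbF ?andbT //.
rewrite -mk mulnC exprM hk cm eqxx /=; apply/andP; split.
  apply: contra_not_neq gk => h1; apply: (m_expr_eq1 (or_intror erefl) gkm).
  by apply: invr_inj; rewrite exprAC -/c -hk h1 expr1n invr1.
apply: contra_not_neq gk => gh; apply: (m_expr_eq1 (or_introl erefl) gkm).
rewrite -(prednK n_gt0) exprS {1}gh hk exprAC mulVf //.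
by rewrite !expf_neq0.
Qed.

Lemma card_unity_q : #|[set g : K | g ^+ q.+1 == 1]| = q.+1.
Proof.
by rewrite (card_nth_roots (esym card_pred) (oner_neq0 _)) expr1n eqxx.
Qed.

Lemma card_unity_k : #|[set g : K | g ^+ k == 1]| = k.
Proof.
by rewrite (card_nth_roots card_pred_k (oner_neq0 _)) expr1n eqxx.
Qed.

Lemma card_slopes : #|slopes| = (k.-1 * (k - 2) + (q.+1 - k) * k)%N.
Proof.
rewrite /slopes (card_set_pair (fun g h => [&& g ^+ q.+1 == 1, h ^+ q.+1 == 1,
  g != 1, h != 1, g != h & (g ^+ n.-1 * h) ^+ k == 1])).
pose V := [set g : K | g ^+ k == 1]; pose U := [set g : K | g ^+ q.+1 == 1].
have VU : V \subset U by apply/subsetP => g; rewrite !inE; exact: unity_k.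
(* Fibers over [g] in [V] other than 1 have [k - 2] elements, those over the rest of [U] have [k].
   For [k = 1] the first set is empty, so truncation in [k - 2] is harmless. *)
have -> : (k.-1 * (k - 2) + (q.+1 - k) * k)%N =
    (\sum_(g in V :\ 1%R) (k - 2) + \sum_(g in U :\: V) k)%N.
  rewrite !sum_nat_const (cardsD U V) (setIidPr VU) card_unity_q card_unity_k.
  by have := cardsD1 1 V; rewrite card_unity_k inE expr1n eqxx => ->.
rewrite [X in (X + _)%N]big_mkcond [X in (_ + X)%N]big_mkcond -big_split /=.
apply: eq_bigr => g _; rewrite /V /U !inE.
have [->|g1] := eqVneq g 1.
  by rewrite expr1n eqxx /= eq_card0 // => h; rewrite !inE /= !andbF.
have [gq|gq] := eqVneq (g ^+ q.+1) 1; last first.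
  have /negPf-> : g ^+ k != 1 by apply: contra gq; exact: unity_k.
  by rewrite eq_card0 // => h; rewrite !inE.
rewrite /= card_slope_fiber //; case: (g ^+ k == 1) => //=.
by rewrite addn0.
Qed.

Lemma expq_pred (x : K) : x ^+ q = x ^+ q.-1 * x.
Proof. by rewrite -exprSr prednK // ltnW. Qed.

Lemma expqN1 : (- 1) ^+ q = - 1 :> K.
Proof.
have := qD 1 (-1); rewrite subrr expr1n expr0n gtn_eqF ?(ltnW q_gt1) //.
by move=> /esym/eqP; rewrite addrC addr_eq0 => /eqP.
Qed.

(** The exponent is [#|K|.-1] divided by [m], so the last condition singles out m-th powers. *)
Definition base_set : {set K} := [set b | [&& b != 0, b != - 1 &
  (- (1 + b) * b ^+ n.-1) ^+ (k * q.-1) == 1]].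

(** As [m] is odd, [- 1] is an m-th power, namely of itself. *)
Lemma sign_kq : (- 1) ^+ (k * q.-1) = 1 :> K.
Proof.
have odd_m : odd m.
  by rewrite mE /=; case: n => // a; rewrite oddM /=; case: (odd a).
have -> : (- 1) = (- 1) ^+ m :> K by rewrite -signr_odd odd_m.
by rewrite -exprM mulnA mk -card_pred finField_exp_eq1 // oppr_eq0 oner_neq0.
Qed.

Lemma base_cond (b : K) : ((- (1 + b) * b ^+ n.-1) ^+ (k * q.-1) == 1) =
  (((b ^+ q.-1) ^+ n.-1 * (1 + b) ^+ q.-1) ^+ k == 1).
Proof.
rewrite -mulN1r !exprMn sign_kq mul1r -!exprM mulrC.
by congr (_ ^+ _ * _ ^+ _ == 1); lia.
Qed.

Lemma card_fixed : #|[set b : K | b ^+ q == b]| = q.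
Proof.
have -> : [set b : K | b ^+ q == b] = 0 |: [set b | b ^+ q.-1 == 1].
  apply/setP => b; rewrite !inE; have [->|b0] := eqVneq b 0.
    by rewrite expr0n gtn_eqF ?eqxx // ltnW.
  by rewrite /= -[RHS](inj_eq (mulIf b0)) /= mul1r -expq_pred.
have eN : (q.-1 * q.+1)%N = #|K|.-1 by rewrite mulnC card_pred.
have z : ((0 : K) ^+ q.-1 == 1) = false.
  have q0 : (0 < q.-1)%N by lia.
  by rewrite expr0n gtn_eqF // eq_sym oner_eq0.
rewrite cardsU1 inE z (card_nth_roots eN (oner_neq0 _)) expr1n eqxx.
by rewrite add1n prednK // ltnW.
Qed.

(** On the fixed field the (q - 1)-th powers of nonzero [b] and [1 + b] are 1, so the power
    condition is automatic and only 0 and -1 drop out. *)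
Lemma card_base_fixed : #|base_set :&: [set b : K | b ^+ q == b]| = (q - 2)%N.
Proof.
have -> : base_set :&: [set b : K | b ^+ q == b] =
    [set b : K | b ^+ q == b] :\ 0 :\ (- 1).
  apply/setP => b; rewrite !inE base_cond.
  have [b0|b0] := eqVneq b 0; first by rewrite andbF.
  have [b1|b1] := eqVneq b (-1); first by [].
  case: (b ^+ q =P b) => bq; rewrite ?andbF ?andbT //=.
  have E (x : K) : x != 0 -> x ^+ q = x -> x ^+ q.-1 = 1.
    by move=> x0 xq; apply: (mulIf x0); rewrite -expq_pred mul1r.
  rewrite E // E ?expr1n ?mulr1 ?expr1n ?eqxx //.
    by rewrite addrC addr_eq0.
  by rewrite qD expr1n bq.
have := cardsD1 0 [set b : K | b ^+ q == b].
rewrite (cardsD1 (-1) (_ :\ 0)) card_fixed !inE expqN1 eqxx oppr_eq0 oner_eq0.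
rewrite expr0n gtn_eqF ?eqxx ?(ltnW q_gt1) //= => E.
by rewrite [in RHS]E !add1n subn2.
Qed.

(** With g = b ^ (q - 1) and h = (1 + b) ^ (q - 1), additivity of the q-th power reads 1 + g b = h
    (1 + b), whence b = (h - 1) / (g - h). *)
Lemma card_base_slopes : #|base_set :\: [set b : K | b ^+ q == b]| = #|slopes|.
Proof.
pose f (b : K) := (b ^+ q.-1, (1 + b) ^+ q.-1).
pose f' (gh : K * K) := (gh.2 - 1) / (gh.1 - gh.2).
have qD1 (b : K) : (1 + b) ^+ q = 1 + b ^+ q by rewrite qD expr1n.
have fixed0 : (0 : K) ^+ q = 0 by rewrite expr0n gtn_eqF // ltnW.
have dom (b : K) : b ^+ q != b -> [/\ b != 0, 1 + b != 0,
    b ^+ q.-1 != 1 & (1 + b) ^+ q.-1 != 1].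
  move=> bq.
  have b0 : b != 0 by apply: contra bq => /eqP->; rewrite fixed0.
  have b1 : 1 + b != 0.
    by apply: contra bq; rewrite addrC addr_eq0 => /eqP->; rewrite expqN1.
  split=> //.
    by apply: contra bq => /eqP E; rewrite expq_pred E mul1r.
  apply: contra bq => /eqP E; rewrite -(inj_eq (addrI 1)) -qD1.
  by rewrite expq_pred E mul1r.
have dist (b : K) : b ^+ q != b -> b ^+ q.-1 != (1 + b) ^+ q.-1.
  move=> bq; have [b0 b1 g1 h1] := dom b bq.
  apply: contra g1 => /eqP E; have := qD1 b; rewrite !expq_pred -E mulrDr mulr1.
  by move/addIr=> ->.
have frob (x y : K) : (x - y) ^+ q = x ^+ q - y ^+ q.
  by rewrite qD -mulN1r exprMn expqN1 mulN1r.
have expqV (x : K) : x ^+ q.+1 = 1 -> x ^+ q = x^-1.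
  move=> xq; have x0 := exprn_eq1_neq0 xq.
  by apply: (mulIf x0); rewrite -exprSr xq mulVf.
have inv (g h : K) : g ^+ q.+1 = 1 -> h ^+ q.+1 = 1 -> g != 1 -> h != 1 ->
    g != h -> let b := (h - 1) / (g - h) in
    [/\ b != 0, 1 + b != 0, b ^+ q.-1 = g & (1 + b) ^+ q.-1 = h].
  move=> gq hq g1 h1 gh b.
  have g0 := exprn_eq1_neq0 gq; have h0 := exprn_eq1_neq0 hq.
  have gh' : g - h != 0 by rewrite subr_eq0.
  have hg' : h - g != 0 by rewrite subr_eq0 eq_sym.
  have b0 : b != 0 by rewrite mulf_neq0 ?invr_eq0 ?subr_eq0.
  have b1E : 1 + b = (g - 1) / (g - h) by rewrite /b; field.
  have b1 : 1 + b != 0 by rewrite b1E mulf_neq0 ?invr_eq0 ?subr_eq0.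
  (* The q-th power inverts [g] and [h], and (1/h - 1) / (1/g - 1/h) = g (h - 1) / (g - h). *)
  have bq : b ^+ q = g * b.
    rewrite expr_div_n !frob (expqV g gq) (expqV h hq) expr1n /b.
    by field; rewrite gh' h0 g0 mulN1r hg'.
  split=> //.
    by apply: (mulIf b0); rewrite -expq_pred.
  by apply: (mulIf b1); rewrite -expq_pred qD1 bq b1E /b; field.
have expU (x : K) : x != 0 -> (x ^+ q.-1) ^+ q.+1 = 1.
  by move=> x0; rewrite -exprM mulnC -card_pred finField_exp_eq1.
apply: (card_set_bij (f := f) (g := f')).
- move=> b; rewrite !inE base_cond /= => /and4P[bq b0 b1 bc].
  have [_ b10 g1 h1] := dom b bq.
  by rewrite !expU // !eqxx g1 h1 dist.
- case=> g h; rewrite !inE base_cond /=.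
  move=> /and5P[/eqP gq /eqP hq g1 h1 /andP[gh ghk]].
  have [b0 b10 -> ->] := inv g h gq hq g1 h1 gh.
  rewrite ghk b0 andbT /f' /= -[_ == - 1]addr_eq0 [_ + 1]addrC b10 !andbT.
  have [_ _ E _] := inv g h gq hq g1 h1 gh.
  rewrite expq_pred E; apply: contra g1 => /eqP E1.
  by rewrite -(inj_eq (mulIf b0)) mul1r E1.
- move=> b; rewrite !inE => /andP[bq _]; rewrite /f /f' /=.
  have gh := dist b bq; have := qD1 b; rewrite !expq_pred.
  move: gh; move: (b ^+ q.-1) ((1 + b) ^+ q.-1) => g h gh E.
  apply: (mulIf (_ : g - h != 0)); rewrite ?divfK ?subr_eq0 //.
  rewrite mulrBr [b * g]mulrC; apply/eqP; rewrite -subr_eq0; apply/eqP.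
  transitivity (h * (1 + b) - (1 + g * b)); first by ring.
  by rewrite E subrr.
- case=> g h; rewrite !inE /= => /and5P[/eqP gq /eqP hq g1 h1 /andP[gh ghk]].
  by have [_ _ E1 E2] := inv g h gq hq g1 h1 gh; rewrite /f /f' /= E1 E2.
Qed.

Definition torus_set : {set K * K} := [set xy | [&& xy.1 != 0, xy.2 != 0 &
  xy.1 ^+ n * xy.2 + xy.2 ^+ n + xy.1 == 0]].

(* The substitution [b = y ^ n / x] is the quotient of the torus by the group
   of m-th roots of unity. *)
Lemma card_torus_base : #|torus_set| = (m * #|base_set|)%N.
Proof.
pose c (b : K) := - (1 + b) * b ^+ n.-1.
pose Q (b y : K) := [&& b != 0, b != - 1 & y ^+ m == c b].
have m_gt0 : (0 < m)%N by rewrite mE.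
have c0 b : b != 0 -> b != - 1 -> c b != 0.
  by move=> b0 b1; rewrite mulf_neq0 ?expf_neq0 // oppr_eq0 addrC addr_eq0.
(* Multiplied by x ^ n and brought to one side, the right-hand equation is the left-hand one times y
   ^ (m - 1). *)
have key (x y : K) : x != 0 -> y != 0 ->
  (x ^+ n * y + y ^+ n + x == 0) = (y ^+ m == c (y ^+ n / x)).
  move=> x0 y0; rewrite /c.
  have -> : - (1 + y ^+ n / x) * (y ^+ n / x) ^+ n.-1 =
      - (x + y ^+ n) * y ^+ (n * n.-1) / x ^+ n.
    have xE : x ^+ n = x * x ^+ n.-1 by rewrite -exprS prednK.
    by rewrite expr_div_n -exprM xE; field; rewrite x0 expf_neq0.
  rewrite -[RHS](inj_eq (mulIf (expf_neq0 n x0))) divfK ?expf_neq0 //.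
  rewrite mE exprSr.
  rewrite -[LHS](inj_eq (mulIf (expf_neq0 (n * n.-1) y0))) mul0r.
  by rewrite -[RHS]subr_eq0; congr (_ == 0); ring.
transitivity #|[set by_ : K * K | Q by_.1 by_.2]|.
  (* On nonzero coordinates this map is an involution, hence serves as its own inverse. *)
  pose f (xy : K * K) := (xy.2 ^+ n / xy.1, xy.2).
  have fK (xy : K * K) : xy.1 != 0 -> xy.2 != 0 -> f (f xy) = xy.
    case: xy => x y /= x0 y0; rewrite /f /=; congr (_, _); field.
    by rewrite x0 expf_neq0.
  apply: (card_set_bij (f := f) (g := f)).
  - case=> x y; rewrite !inE /= => /and3P[x0 y0].
    rewrite key // /Q => yc; rewrite yc andbT.
    have := expf_neq0 m y0; rewrite (eqP yc) mulf_eq0 negb_or oppr_eq0.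
    rewrite addrC addr_eq0 => /andP[-> _].
    by rewrite mulf_neq0 ?invr_eq0 ?expf_neq0.
  - case=> b y; rewrite !inE /= => /and3P[b0 b1 yc].
    have y0 : y != 0.
      apply: contraNneq (c0 b b0 b1) => y0.
      by rewrite -(eqP yc) y0 expr0n gtn_eqF.
    have x0 : y ^+ n / b != 0 by rewrite mulf_neq0 ?invr_eq0 ?expf_neq0.
    rewrite x0 y0 key //; have [-> //] := fK (b, y) b0 y0.
  - case=> x y; rewrite !inE /= => /and3P[x0 y0 _]; exact: fK.
  - case=> b y; rewrite !inE /= => /and3P[b0 b1 yc]; apply: fK => //=.
    apply: contraNneq (c0 b b0 b1) => y0.
    by rewrite -(eqP yc) y0 expr0n gtn_eqF.
rewrite card_set_pair mulnC -sum_nat_const [RHS]big_mkcond /=.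
apply: eq_bigr => b _; rewrite inE /Q.
have [b0|b0] := eqVneq b 0; first by rewrite eq_card0 // => y; rewrite inE.
have [b1|b1] := eqVneq b (-1); first by rewrite eq_card0 // => y; rewrite inE.
by rewrite /= (@card_nth_roots _ m (k * q.-1)) ?c0 // mulnA mk card_pred.
Qed.

(** The slopes number (q - 2) k + 2 and m k = q + 1, so the torus has m q + (q - 2)(q + 1)
    points. *)
Lemma card_torus : (#|torus_set| + 2)%N = (q ^ 2 + n * n.-1 * q)%N.
Proof.
rewrite card_torus_base -(cardsID [set b : K | b ^+ q == b] base_set).
rewrite card_base_fixed card_base_slopes card_slopes.
have k0 := k_gt0; have kq : (k <= q.+1)%N by rewrite -mk mE; nia.
move: mk mE => mk' mE'; rewrite -/m in mk'.
have e : (n * n.-1 = m - 1)%N by rewrite mE'; lia.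
rewrite {}e -mulnn.
have m_gt0 : (0 < m)%N by rewrite mE'.
move: (m) mk' m_gt0 => m' mk' m_gt0; clear mE' cardK qD.
case: q q_gt1 mk' kq => [|[|a]] // _ mk' kq.
have -> : (k.-1 * (k - 2) + (a.+3 - k) * k = a * k + 2)%N.
  case: k k0 kq {mk'} => [|[|b]] // _ kq; first by lia.
  have [c aE] : exists c, a.+1 = (b + c)%N by exists (a.+1 - b)%N; lia.
  have -> : (a.+3 - b.+2 = c)%N by lia.
  case: b c aE {kq} => [|b] [|c] aE; first by lia.
  - have -> : a = c by lia.
    lia.
  - have -> : a = b by lia.
    lia.
  - have -> : a = (b + c.+1)%N by lia.
    lia.
have akE : (m' * (a * k) = a * a.+3)%N by rewrite mulnCA mk'.
rewrite (_ : a.+2 - 2 = a)%N; last by lia.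
rewrite !mulnDr akE; case: m' m_gt0 {akE mk'} => // m' _.
by lia.
Qed.
End TorusCount.

(** * From the torus to the projective plane *)

Definition row3 (K : fieldType) (x y z : K) : 'rV[K]_3 :=
  \row_i [tuple x; y; z]`_i.

Lemma row3P (K : fieldType) (w : 'rV[K]_3) : w = row3 (w 0 0) (w 0 1) (w 0 2%R).
Proof.
apply/rowP => i; rewrite mxE; case: i => [[|[|[|i]]] hi] //=;
  congr (w _ _); exact/val_inj.
Qed.

Lemma row3_inj (K : fieldType) (x y z x' y' z' : K) :
  row3 x y z = row3 x' y' z' -> [/\ x = x', y = y' & z = z'].
Proof.
move=> /rowP E; split; first by have := E 0; rewrite !mxE.
  by have := E 1; rewrite !mxE.
by have := E 2%R; rewrite !mxE.
Qed.

Lemma scale_row3 (K : fieldType) (a x y z : K) :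
  a *: row3 x y z = row3 (a * x) (a * y) (a * z).
Proof. by apply/rowP => i; rewrite !mxE; case: i => [[|[|[|i]]] hi]. Qed.

Lemma row3_eq0 (K : fieldType) (x y z : K) :
  (row3 x y z == 0) = [&& x == 0, y == 0 & z == 0].
Proof.
apply/eqP/and3P => [E|[/eqP-> /eqP-> /eqP->]]; last first.
  by apply/rowP => i; rewrite !mxE; case: i => [[|[|[|i]]] hi].
have : row3 x y z = row3 0 0 0.
  by rewrite E; apply/rowP => i; rewrite !mxE; case: i => [[|[|[|i]]] hi].
by case/row3_inj => -> -> ->.
Qed.

Lemma hurwitz_row3 (K : fieldType) (n : nat) (x y z : K) :
  (hurwitz K n).@[row3 x y z 0] = x ^+ n * y + y ^+ n * z + z ^+ n * x.
Proof. by rewrite !mevalD !mevalM !rmorphXn /= !mevalXU !mxE. Qed.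

(* Every point has a unique representative whose last nonzero coordinate
   is 1. *)
Lemma card_hurwitz_points (K : finFieldType) (n : nat) : (0 < n)%N ->
  #|rational_points (hurwitz K n)| = (#|torus_set K n| + 3)%N.
Proof.
move=> n_gt0.
pose T := [set row3 xy.1 xy.2 1 | xy in torus_set K n].
(* The curve meets the coordinate axes only in the three coordinate points, added here to the
   torus. *)
pose S := row3 1 0 0 |: (row3 0 1 0 |: (row3 0 0 1 |: T)).
have e0 j : (0 : K) ^+ j.+1 = 0 by rewrite expr0n.
have n1 := prednK n_gt0.
have z0n : (0 : K) ^+ n = 0 by rewrite -n1 e0.
have TP (w : 'rV[K]_3) : w \in T -> exists x y,
    [/\ w = row3 x y 1, x != 0, y != 0 & x ^+ n * y + y ^+ n + x = 0].
  move=> /imsetP[[x y]]; rewrite inE /= => /and3P[x0 y0 /eqP E] ->.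
  by exists x, y.
have Snz (w : 'rV[K]_3) : w \in S ->
  (w != 0) && ((hurwitz K n).@[w 0] == 0).
  rewrite !inE => /or4P[/eqP->|/eqP->|/eqP->|/TP[x [y [-> x0 y0 E]]]];
    rewrite row3_eq0 hurwitz_row3 ?eqxx ?oner_eq0 ?andbF /=.
  - by rewrite z0n !(mul0r, mulr0, addr0) eqxx.
  - by rewrite z0n !(mul0r, mulr0, addr0) eqxx.
  - by rewrite z0n !(mul0r, mulr0, addr0) eqxx.
  - by rewrite mulr1 expr1n mul1r E eqxx.
have S1 (x y : K) : x ^+ n * y + y ^+ n + x = 0 -> row3 x y 1 \in S.
  move=> E; have [x0|x0] := eqVneq x 0.
    move: E; rewrite x0 z0n mul0r add0r addr0 => /eqP.
    by rewrite expf_eq0 n_gt0 /= => /eqP->; rewrite !inE eqxx !orbT.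
  have y0 : y != 0.
    by apply: contra_eq_neq E => ->; rewrite mulr0 z0n !add0r.
  rewrite !inE; apply/or4P/Or44/imsetP; exists (x, y) => //.
  by rewrite inE /= x0 y0 E eqxx.
have SP (w : 'rV[K]_3) : (w != 0) && ((hurwitz K n).@[w 0] == 0) ->
  exists2 a, a != 0 & a *: w \in S.
  rewrite (row3P w) row3_eq0 hurwitz_row3.
  move: (w 0 0) (w 0 1) (w 0 2%R) => x y z /andP[xyz /eqP E].
  have [z0|z0] := eqVneq z 0; last first.
    exists z^-1; rewrite ?invr_eq0 // scale_row3 mulVf //.
    apply: S1; rewrite ![z^-1 * _]mulrC !expr_div_n.
    apply: (mulIf (expf_neq0 n z0)); apply: (mulIf z0); rewrite !mul0r -[RHS]E.
    by field; rewrite z0 expf_neq0.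
  move: E; rewrite z0 z0n !(mulr0, mul0r, addr0) => /eqP.
  rewrite mulf_eq0 expf_eq0 n_gt0 /=.
  have [y0 _|y0] := eqVneq y 0.
    move: xyz; rewrite z0 y0 eqxx !andbT => x0.
    by exists x^-1; rewrite ?invr_eq0 // scale_row3 mulVf // !mulr0 !inE eqxx.
  rewrite orbF => /eqP->.
  exists y^-1; rewrite ?invr_eq0 // scale_row3 mulVf // !mulr0.
  by rewrite !inE eqxx orbT.
have Snorm (w : 'rV[K]_3) : w \in S -> exists x y z, w = row3 x y z /\
    [\/ z = 1, z = 0 /\ y = 1 | [/\ z = 0, y = 0 & x = 1]].
  rewrite !inE => /or4P[/eqP->|/eqP->|/eqP->|/TP[x [y [-> _ _ _]]]].
  - by exists 1, 0, 0; split=> //; apply: Or33.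
  - by exists 0, 1, 0; split=> //; apply: Or32.
  - by exists 0, 0, 1; split=> //; apply: Or31.
  - by exists x, y, 1; split=> //; apply: Or31.
(* Representatives of one point differ by a scalar [a]; comparing their last nonzero coordinates,
   both 1, gives a = 1. *)
have Sinj : {in S &, injective (@proj_point K)}.
  move=> w w' wS w'S E.
  have /imsetP[a a0 wE] : w' \in proj_point w.
    by rewrite E; apply/imsetP; exists 1; rewrite ?inE ?oner_eq0 ?scale1r.
  rewrite inE in a0; suff a1 : a = 1 by rewrite wE a1 scale1r.
  have := Snorm _ w'S; have := Snorm _ wS; rewrite {}wE => -[x [y [z [-> h]]]].
  rewrite scale_row3 => -[x' [y' [z' [/row3_inj[<- <- <-]]]]].
  case: h => [->|[-> ->]|[-> -> ->]]; rewrite ?mulr1 ?mulr0.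
  - by case=> // -[/eqP]; rewrite (negPf a0).
  - by case=> [/eqP|[_ ->]|[_ /eqP]] //; rewrite ?(negPf a0) // eq_sym oner_eq0.
  - by case=> [/eqP|[_ /eqP]|[_ _ ->]] //; rewrite eq_sym oner_eq0.
have -> : rational_points (hurwitz K n) = proj_point (K:=K) @: S.
  apply/setP => P; apply/imsetP/imsetP => [[w]|[w wS ->]]; last first.
    by exists w; rewrite // inE Snz.
  rewrite inE => /SP[a a0 aw] ->; exists (a *: w) => //.
  apply/setP => u; apply/imsetP/imsetP => [[b b0 ->]|[b b0 ->]].
    rewrite inE in b0; exists (b / a); last by rewrite scalerA divfK.
    by rewrite inE mulf_neq0 ?invr_eq0.
  rewrite inE in b0; exists (b * a); last by rewrite scalerA.
  by rewrite inE mulf_neq0.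
rewrite (card_in_imset Sinj) /S !cardsU1 card_imset; last first.
  by move=> [x y] [x' y'] /row3_inj[/= -> -> _].
have nT (x y z : K) : [|| z != 1, x == 0 | y == 0] -> row3 x y z \notin T.
  move=> h; apply/negP => /TP[x' [y' [/row3_inj[xx yy zz] x0 y0 _]]].
  by move: h; rewrite xx yy zz (negPf x0) (negPf y0) eqxx.
have ne (x y z x' y' z' : K) : [|| x != x', y != y' | z != z'] ->
    (row3 x y z == row3 x' y' z') = false.
  move=> h; apply/eqP => /row3_inj[xx yy zz].
  by move: h; rewrite xx yy zz !eqxx.
have o1 : (0 == 1 :> K) = false by rewrite eq_sym oner_eq0.
rewrite !inE !ne ?oner_eq0 ?o1 ?orbT //=.
by rewrite !nT ?o1 ?eqxx ?orbT //= !add1n addn3.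
Qed.

(** The hypothesis on [p] makes m = n (n - 1) + 1 nonzero in [K], which gives nonsingularity. The
    genus satisfies 2 g = n (n - 1), and the three coordinate points raise the torus count q ^ 2 + 2
    g q - 2 to the maximal value. *)
Lemma hurwitz_maximal (K : finFieldType) (n p N : nat) :
  prime p -> (1 < n)%N -> (p %| n * n.-1)%N -> #|K| = ((p ^ N) ^ 2)%N ->
  (n ^ 2 - n + 1 %| (p ^ N).+1)%N -> maximal_curve (p ^ N) (hurwitz K n).
Proof.
move=> p_pr n_gt1 pn cK; have n_gt0 := ltnW n_gt1.
have q_gt1 : (1 < p ^ N)%N.
  by have := finNzRing_gt1 K; rewrite cK; case: (p ^ N)%N => [|[|]].
have Kp : p \in [pchar K].
  by apply: (@card_finPcharP _ p (N * 2)) => //; rewrite expnM.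
have m0 : (n ^ 2 - n + 1)%N%:R != 0 :> K.
  rewrite -(dvdn_pcharf Kp) sqr_sub_addn1 //.
  by rewrite -addn1 dvdn_addr // dvdn1 neq_ltn prime_gt1 ?orbT.
move=> /dvdnP[k]; rewrite mulnC => mk; split.
- split; first exact: hurwitz_neq0.
  by exists n.+1; last exact: hurwitz_homog.
- by move=> L iota; rewrite map_hurwitz; exact: hurwitz_irreducible.
- exact: hurwitz_nonsingular.
exists 'C(n, 2).
  exact: plane_curve_genus (hurwitz_neq0 _ n_gt1) (hurwitz_homog _ _).
have qD : {morph (fun x : K => x ^+ (p ^ N)) : x y / x + y}.
  by move=> x y; apply: exprDn_pchar; rewrite pnatX pnatE // Kp.
rewrite card_hurwitz_points //.
have := card_torus qD q_gt1 cK n_gt0 (esym mk).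
have := mul_bin_diag n 1; rewrite bin1 => ->.
by rewrite addn3 mulnAC -addnA add1n => <-; rewrite addn2.
Qed.

(** * Divisibility of q + 1 by n ^ 2 - n + 1 *)

(** This is the factorization of (X ^ p - 1) / (X - 1) evaluated at 1. *)
Lemma prod_one_sub_prim_root (F : fieldType) (p : nat) (z : F) :
  p.-primitive_root z -> \prod_(1 <= i < p) (1 - z ^+ i) = p%:R.
Proof.
move=> pz; have p0 := prim_order_gt0 pz.
have : \prod_(1 <= i < p) ('X - (z ^+ i)%:P) = \sum_(i < p) 'X^i.
  have X1 : 'X - 1%:P != 0 :> {poly F} by rewrite polyXsubC_eq0.
  apply: (mulfI X1); rewrite polyC1 -subrX1 -(factor_Xn_sub_1 pz).
  by rewrite [RHS]big_ltn // expr0.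
move=> /(congr1 (fun P => P.[1])); rewrite horner_prod horner_sum.
rewrite (eq_bigr (fun i => 1 - z ^+ i)) => [->|i _]; last by rewrite !hornerE.
under eq_bigr do rewrite hornerXn expr1n.
by rewrite sumr_const card_ord.
Qed.

(* The factors [1 - z ^ i] and [1 - z ^ (p - i)] are associated by
   [- z ^ - i], and [z] is a square. *)
Lemma prime_mod4_eq_oppsq (F : fieldType) (p : nat) (z : F) :
  p.-primitive_root z -> p = 3 %[mod 4] -> exists t : F, p%:R = - t ^+ 2.
Proof.
move=> pz p3; pose h := p./2.
have pE : p = h.*2.+1 by rewrite /h; lia.
have oh : odd h by rewrite /h; lia.
have z0 : z != 0.
  by apply: (@exprn_eq1_neq0 _ h.*2); rewrite -pE prim_expr_order.
(* As [p] is odd, z ^ ((p + 1) / 2) is a square root of [z]. *)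
pose s := z ^+ h.+1.
have s2 : s ^+ 2 = z.
  rewrite -exprM (_ : (h.+1 * 2 = p + 1)%N); last by lia.
  by rewrite exprD (prim_expr_order pz) mul1r expr1.
(* With j = i + 1, the product of 1 - z ^ j and 1 - z ^ (- j) is - (s ^ (- j) (1 - z ^ j)) ^ 2. The
   number [h] of such pairs is odd, so one sign remains. *)
exists (\prod_(0 <= i < h) (s ^- i.+1 * (1 - z ^+ i.+1))).
rewrite -(prod_one_sub_prim_root pz) (@big_cat_nat _ _ _ h.+1) //=; last by lia.
have -> : \prod_(h.+1 <= i < p) (1 - z ^+ i) =
    \prod_(0 <= i < h) (1 - z ^+ (i + h.+1)).
  by rewrite -{1}[h.+1]add0n big_addn (_ : p - h.+1 = h)%N //; lia.
rewrite big_add1 /=.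
rewrite [X in _ * X]big_nat_rev /= -big_split /= -prodrXl.
rewrite -mulN1r -[in RHS](_ : \prod_(0 <= i < h) (-1) = -1 :> F); last first.
  by rewrite prodr_const_nat subn0 -signr_odd oh.
rewrite -big_split /=; apply: eq_big_nat => i /andP[_ ih].
rewrite (_ : 0 + h - i.+1 + h.+1 = p - i.+1)%N; last by lia.
have zi : z ^+ (p - i.+1) = (z ^+ i.+1)^-1.
  apply: (mulIf (expf_neq0 i.+1 z0)); rewrite mulVf ?expf_neq0 // -exprD subnK.
    by rewrite (prim_expr_order pz).
  by lia.
rewrite zi exprMn exprVn -exprM mulnC exprM s2.
by field; rewrite expf_neq0.
Qed.

(** In the field with [m] elements p = - t ^ 2; raised to the odd power (m - 1) / 2 this gives - t ^
    (m - 1) = - 1. *)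
Lemma exprn_half_eqN1 (m p : nat) :
  prime m -> m = 3 %[mod 4] -> p = 3 %[mod 4] -> (p %| m.-1)%N ->
  (m %| (p ^ (m.-1)./2).+1)%N.
Proof.
move=> m_pr m3 p3 pm; have Fm := pchar_Fp m_pr.
have cF : #|'F_m| = m by rewrite card_Fp.
have m1 : (0 < m.-1)%N by have := prime_gt1 m_pr; lia.
have [w pw] := finField_prim_root 'F_m.
rewrite cF in pw; have pz := dvdn_prim_root pw pm.
have [t pt] := prime_mod4_eq_oppsq pz p3.
(* Here 0 < p < m, so [p] is nonzero modulo [m]. *)
have t0 : t != 0.
  apply/eqP => t0; move/eqP: pt; rewrite t0 expr0n oppr0 -(dvdn_pcharf Fm).
  apply/negP/negP; rewrite gtnNdvd //; first by case: (p) p3.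
  by have := dvdn_leq m1 pm; move: m1; clear; lia.
rewrite (dvdn_pcharf Fm) -natr1 natrX pt exprNn -signr_odd.
have -> : odd (m.-1)./2 by lia.
rewrite -exprM (_ : 2 * (m.-1)./2 = m.-1)%N; last by lia.
by have := finField_exp_eq1 t0; rewrite cF => ->; rewrite mulr1 expr1 addNr.
Qed.

Lemma coprime_dvd_pred (p m : nat) : (0 < m)%N -> (p %| m.-1)%N -> coprime p m.
Proof.
case: m => // m _ /= pm; rewrite /coprime -dvdn1.
have pm' : (gcdn p m.+1 %| m)%N := dvdn_trans (dvdn_gcdl _ _) pm.
by have := dvdn_sub (dvdn_gcdr p m.+1) pm'; rewrite subSnn.
Qed.

Theorem corollary3p8 (n p v : nat) (hn : (0 < n)%N) (hp : prime p) :
  let m := (n ^ 2 - n + 1)%N in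
  (forall e : nat, (1 <= e)%N -> n = (p ^ e)%N ->
     let q := (p ^ (totient m * v + 3 * e))%N in
     forall K : finFieldType, #|K| = (q ^ 2)%N ->
       maximal_curve q (hurwitz K n))
  /\
  (p = 3 %[mod 4] -> (n = 0 %[mod p] \/ n = 1 %[mod p]) ->
     prime m -> m = 3 %[mod 4] ->
     let q := (p ^ ((m - 1) * v + (m - 1) %/ 2))%N in
     forall K : finFieldType, #|K| = (q ^ 2)%N ->
       maximal_curve q (hurwitz K n)).
Proof.
move=> m; have mE : m = (n * n.-1).+1 := sqr_sub_addn1 hn.
(* By Euler's theorem the part of the exponent containing [v] contributes a factor 1 modulo [m],
   which this removes. *)
have dvd_succ a b : a = 1 %[mod m] -> (m %| b.+1)%N -> (m %| (a * b).+1)%N.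
  move=> a1; suff E : (a * b + 1 = b + 1 %[mod m])%N.
    by rewrite /dvdn -!(addn1 (_ * _)) -(addn1 b) E.
  by apply/eqP; rewrite eqn_modDr -modnMml a1 modnMml mul1n.
split=> [e e0 nE q K cK|p3 n01 m_pr m3 q K cK].
  have pn : (p %| n)%N by rewrite nE dvdn_exp.
  have n1 : (1 < n)%N by rewrite nE -(exp1n e) ltn_exp2r // prime_gt1.
  apply: hurwitz_maximal => //; first by rewrite dvdn_mulr.
  rewrite -/m expnD; apply: dvd_succ.
    rewrite expnM -modnXm Euler_exp_totient ?modnXm ?exp1n //.
    by apply: coprime_dvd_pred; rewrite mE ?dvdn_mulr.
  (* Here p ^ (3 e) = n ^ 3, and n ^ 3 + 1 = (n + 1)(n ^ 2 - n + 1). *)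
  apply/dvdnP; exists n.+1.
  rewrite mulnC expnM -nE mE; case: (n) hn => // a _; lia.
have n1 : (1 < n)%N.
  by move: m_pr; rewrite mE; case: (n) hn => [|[]].
have pm : (p %| n * n.-1)%N.
  case: n01 => /eqP; first by rewrite mod0n => pn; rewrite dvdn_mulr.
  by rewrite eqn_mod_dvd // subn1 => pn; rewrite dvdn_mull.
apply: hurwitz_maximal => //.
rewrite -/m subn1 expnD; apply: dvd_succ.
  rewrite expnM -modnXm -totient_prime // Euler_exp_totient ?modnXm ?exp1n //.
  by apply: coprime_dvd_pred; rewrite mE.
by rewrite divn2; apply: exprn_half_eqN1 => //; rewrite mE.
Qed.
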